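(* Let $d\ge 2$, let $X=(\mathbf{x}_1,\ldots,\mathbf{x}_n)\in\mathbb{R}^{d\times n}$, and let $A=\frac1n XX^\top\ne 0$, with unit leading eigenvector $\mathbf{v}_1$ (i.e. an eigenvector for the largest eigenvalue of $A$). Let $\mathbf{w}$ be sampled from the standard Gaussian distribution on $\mathbb{R}^d$, and let $\mathbf{w}_0=A\mathbf{w}/\|A\mathbf{w}\|$. Then for any $\delta>0$, with probability at least $1-\frac1d-\delta$, $$\langle\mathbf{v}_1,\mathbf{w}_0\rangle^2\ge\frac{\delta^2}{12\log(d)\,\mathrm{nrank}(A)},$$ where $\mathrm{nrank}(A)=\frac{\|A\|_F^2}{\|A\|_{sp}^2}$ is the numerical rank of $A$.
   Context: $\|\cdot\|_F$ is the Frobenius norm and $\|\cdot\|_{sp}$ the spectral norm; $\log$ is the natural logarithm. *)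

(* Defs.v *)
From HB Require Import structures.
From mathcomp Require Import all_boot all_order all_algebra.
From mathcomp Require Import all_classical all_reals all_analysis.
Set Implicit Arguments.
Unset Strict Implicit.
Unset Printing Implicit Defensive.
Import Order.TTheory GRing.Theory Num.Theory.
Import numFieldNormedType.Exports.
Local Open Scope classical_set_scope.
Local Open Scope ring_scope.

Definition inner (R : realType) (d : nat) (u v : 'cV[R]_d) : R :=
  \sum_(i < d) u i 0 * v i 0.

(* The library's norm on matrices, used for its topology, is the sup norm. *)
Definition norm2 (R : realType) (d : nat) (u : 'cV[R]_d) : R :=
  Num.sqrt (inner u u).

Definition frobenius_norm (R : realType) (m n : nat) (A : 'M[R]_(m, n)) : R :=
  Num.sqrt (\sum_(i < m) \sum_(j < n) A i j ^+ 2).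

Definition spectral_norm (R : realType) (m n : nat) (A : 'M[R]_(m, n)) : R :=
  sup [set norm2 (A *m x) | x in [set x : 'cV[R]_n | norm2 x <= 1]].

Definition nrank (R : realType) (m n : nat) (A : 'M[R]_(m, n)) : R :=
  frobenius_norm A ^+ 2 / spectral_norm A ^+ 2.

(* [eigenvalue] is defined through row vectors ([u *m A = a *: u]); a square
   matrix has the same eigenvalues for row and for column vectors. *)
Definition leading_eigenvector (R : realType) (d : nat) (A : 'M[R]_d)
    (v : 'cV[R]_d) : Prop :=
  v != 0 /\
  exists lambda : R,
    A *m v = lambda *: v /\ forall a : R, eigenvalue A a -> a <= lambda.

(* The standard Gaussian distribution on R^d is the d-fold product of N(0, 1);
   it is determined by its values on the measurable boxes. *)
Definition standard_gaussian (R : realType) (d : nat)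
    (mu : set (d.-tuple R) -> \bar R) : Prop :=
  forall B : 'I_d -> set R, (forall i, measurable (B i)) ->
    mu [set w | forall i, B i (tnth w i)] =
    (\prod_(i < d) normal_prob 0 1 (B i))%E.

Definition cvec (R : realType) (d : nat) (w : d.-tuple R) : 'cV[R]_d :=
  \col_(i < d) tnth w i.

(* [normalize 0 = 0], since [0^-1 = 0]. *)
Definition normalize (R : realType) (d : nat) (u : 'cV[R]_d) : 'cV[R]_d :=
  (norm2 u)^-1 *: u.

(* Main.v *)
(* Write |A w|^2 as the sum over the rows a_i of <a_i, w>^2. Every form <u, w> with
   |u| = 1 has law N(0, 1): adding one coordinate at a time convolves two centred
   Gaussian laws. Hence P(<v1, w>^2 < delta^2) <= delta, because the normal
   density is at most 1/2. By convexity of exp, the variable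
   exp(|A w|^2 / (4 |A|_F^2)) is at most a convex combination of the variables
   exp(Z_i^2 / 4) with Z_i of law N(0, 1), so its expectation is at most sqrt 2,
   and Markov's inequality gives |A w|^2 < 12 log d |A|_F^2 up to probability
   sqrt 2 / d^3 <= 1 / d. Off these two events the bound follows from
   <v1, A w> = l <v1, w>, where the leading eigenvalue l is at least the spectral
   norm because A is positive semidefinite. *)
Require Import Defs.
From HB Require Import structures.
From mathcomp Require Import all_boot all_order all_algebra.
From mathcomp Require Import all_classical all_reals all_analysis.
From mathcomp Require Import measurable_realfun.
From mathcomp Require Import complex spectral.
From mathcomp Require Import ring lra.
Import Order.TTheory GRing.Theory Num.Theory.
Import numFieldNormedType.Exports.
Local Open Scope classical_set_scope.
Local Open Scope ring_scope.

(** * Spectral norm of positive semidefinite matrices *)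

Section Spectral.
Variables (R : realType) (d : nat).
Implicit Types (A : 'M[R]_d) (x y : 'cV[R]_d).

Lemma innerE x y : (x^T *m y) 0 0 = inner x y.
Proof. by rewrite mxE; apply: eq_bigr => i _; rewrite mxE. Qed.

Lemma inner_ge0 x : 0 <= inner x x.
Proof. by apply: sumr_ge0 => i _; rewrite -expr2 sqr_ge0. Qed.

Lemma inner_eq0 x : (inner x x == 0) = (x == 0).
Proof.
apply/idP/eqP => [|->]; last first.
  by rewrite /inner big1// => i _; rewrite mxE mul0r.
rewrite psumr_eq0 => [/allP x0|i _]; last by rewrite -expr2 sqr_ge0.
apply/matrixP => i j; rewrite ord1 mxE.
by have /eqP := x0 i (mem_index_enum i) => /eqP; rewrite mulf_eq0 orbb => /eqP.
Qed.

Lemma norm2_sqr x : norm2 x ^+ 2 = inner x x.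
Proof. by rewrite sqr_sqrtr// inner_ge0. Qed.

Lemma eigenvalue_psd A a : (forall x, 0 <= inner x (A *m x)) -> A^T = A ->
  eigenvalue A a -> 0 <= a.
Proof.
move=> A0 AT /eigenvalueP[v vA v0].
have vT0 : v^T != 0 by rewrite trmx_eq0.
have := A0 v^T.
have -> : A *m v^T = a *: v^T by rewrite -{1}AT -trmx_mul vA linearZ.
rewrite -innerE -scalemxAr mxE innerE pmulr_lge0// lt_neqAle inner_ge0 andbT.
by rewrite eq_sym inner_eq0.
Qed.

(** The diagonalisation below lives over [R[i]]; on vectors with real entries, which conjugation
    fixes, its Hermitian form is the real inner product. *)
Lemma inner_complexE x (xC := map_mx (real_complex R) x) :
  ((xC^T ^ Num.conj)%sesqui *m xC) 0 0 = real_complex R (inner x x).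
Proof.
rewrite mxE rmorph_sum; apply: eq_bigr => i _; rewrite !mxE rmorphM.
by congr (_ * _); apply/CrealP/complex_realP; exists (x i 0).
Qed.

(** A unitary [U] diagonalises A over [R[i]]. In the coordinates z = U x the two sides are the sums
    of |D_i z_i|^2 and of l^2 |z_i|^2, and each D_i is an eigenvalue of A in [0, l]. *)
Lemma norm_mulmx_psd A (l : R) x :
  (forall x, 0 <= inner x (A *m x)) -> A^T = A ->
  (forall a, eigenvalue A a -> a <= l) ->
  inner (A *m x) (A *m x) <= l ^+ 2 * inner x x.
Proof.
move=> A0 AT Al.
pose f : {rmorphism R -> R[i]} := real_complex R.
have f_real (a : R) : f a \is Num.real by apply/complex_realP; exists a.
pose M := map_mx f A.
have hM : M \is hermsymmx.
  apply: realsym_hermsym; last by apply/mxOverP => i j; rewrite mxE.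
  by apply/is_hermitianmxP; rewrite expr0 scale1r map_mx_id// /M map_trmx AT.
set U := spectralmx M; set D := spectral_diag M.
have UU : U \is unitarymx := spectral_unitarymx M.
have ME : M = invmx U *m diag_mx D *m U.
  exact/orthomx_spectralP/hermitian_normalmx.
have UM : U *m M = diag_mx D *m U.
  by rewrite ME !mulmxA mulmxV ?mul1mx// unitarymx_unit.
(* D_i is real because [M] is Hermitian, and row i of [U] is a left eigenvector for it;
   [eigenvalue_map] brings the eigenvalue back to A. *)
have Dle i : `|D 0 i| ^+ 2 <= f (l ^+ 2).
  have /mxOverP/(_ 0 i)/complex_realP[a Da] := hermitian_spectral_diag_real hM.
  have : eigenvalue M (f a).
    apply/eigenvalueP; exists (row i U).
      rewrite -row_mul UM row_mul row_diag_mx -scalemxAl -rowE.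
      by rewrite -/D in Da; rewrite Da.
    (* A zero row of [U] would give a zero row in U U^-1 = 1. *)
    apply: contraTneq (unitarymx_unit UU) => U0.
    apply/negP => /mulmxV/(congr1 (row i)).
    rewrite row_mul U0 mul0mx => /rowP/(_ i).
    by rewrite !mxE eqxx => /eqP; rewrite eq_sym oner_eq0.
  rewrite eigenvalue_map => ev.
  have a0 := eigenvalue_psd A a A0 AT ev; have al := Al _ ev.
  rewrite -/D in Da; rewrite Da real_normK; last exact: f_real.
  rewrite -rmorphXn/= lecR ler_sqr ?nnegrE//.
  exact: le_trans a0 al.
pose xC := map_mx f x; pose z := U *m xC.
have sqE (y : 'cV[R[i]]_d) :
    ((y^T ^ Num.conj)%sesqui *m y) 0 0 = \sum_i `|y i 0| ^+ 2.
  by rewrite mxE; apply: eq_bigr => i _; rewrite !mxE mulrC normCK.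
have UnE (y : 'cV[R[i]]_d) :
    (((U *m y)^T ^ Num.conj)%sesqui *m (U *m y)) = ((y^T ^ Num.conj)%sesqui *m y).
  rewrite trmx_mul map_mxM -mulmxA (mulmxA _ U) -(invmx_unitary UU).
  by rewrite mulVmx ?mul1mx// unitarymx_unit.
have xE : f (inner x x) = \sum_i `|z i 0| ^+ 2.
  by rewrite -sqE UnE; exact: esym (inner_complexE x).
have AxE : f (inner (A *m x) (A *m x)) = \sum_i `|(U *m M *m xC) i 0| ^+ 2.
  rewrite -sqE -mulmxA UnE -(map_mxM f A x).
  exact: esym (inner_complexE _).
rewrite -lecR -[leLHS]/(f _) -[leRHS]/(f _) AxE rmorphM xE UM mulr_sumr.
apply: ler_sum => i _; rewrite -mulmxA -/z mul_diag_mx mxE normrM exprMn.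
by apply: ler_wpM2r (Dle i); rewrite exprn_ge0.
Qed.

Lemma spectral_norm_le A l : 0 <= l ->
  (forall x, inner (A *m x) (A *m x) <= l ^+ 2 * inner x x) ->
  0 <= spectral_norm A <= l.
Proof.
move=> l0 Al.
have ubl : ubound [set norm2 (A *m x) | x in [set x | norm2 x <= 1]] l.
  move=> _ [x /= x1 <-]; rewrite -(@ler_pXn2r _ 2)//; last exact: sqrtr_ge0.
  rewrite norm2_sqr (le_trans (Al x))// -norm2_sqr ler_piMr ?sqr_ge0//.
  by rewrite expr_le1// sqrtr_ge0.
have norm20 : norm2 (0 : 'cV[R]_d) = 0.
  by rewrite /norm2 /inner big1 ?sqrtr0// => i _; rewrite mxE mul0r.
(* x = 0 puts 0 in the set: this gives the lower bound, and the nonemptiness that the upper bound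
   needs. *)
have S0 : [set norm2 (A *m x) | x in [set x | norm2 x <= 1]] 0.
  by exists 0; rewrite /= ?mulmx0 norm20.
apply/andP; split.
  by apply: ub_le_sup => //; exists l.
by apply: ge_sup => //; exists 0.
Qed.

End Spectral.

(** * Normal distributions *)

Section Gaussian.
Context {R : realType}.
Local Notation mu := (@lebesgue_measure R).
Local Notation mR := (measurableTypeR R).
Implicit Types (a b c m s x y : R).

(** The Radon-Nikodym derivative of [normal_prob] and the density [normal_pdf] have the same
    integral over every measurable subset of U, so they agree almost everywhere there. *)
Lemma integral_normal_prob m s (f : R -> \bar R) (U : set R) : measurable U ->
  measurable_fun U f -> (forall x, 0 <= f x)%E ->
  (\int[normal_prob m s]_(x in U) f x =
   \int[mu]_(x in U) (f x * (normal_pdf m s x)%:E))%E.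
Proof.
move=> mU mf f0.
have dom := @normal_prob_dominates R m s.
rewrite -(Radon_Nikodym_SigmaFinite.change_of_variables dom)//=.
have mpdf : measurable_fun U (fun x => (normal_pdf m s x)%:E).
  by apply/measurable_funTS/measurableT_comp => //; exact: measurable_normal_pdf.
have iRN := Radon_Nikodym_SigmaFinite.f_integrable dom.
apply: ae_eq_integral => //.
- apply: emeasurable_funM => //; apply: measurable_funTS.
  exact: measurable_int iRN.
- exact: emeasurable_funM.
- apply: ae_eqe_mul2l; apply: integral_ae_eq => //.
  + exact: integrableS iRN.
  + by move=> E EU mE; rewrite -Radon_Nikodym_SigmaFinite.f_integral.
Qed.

Definition affine x b (y : measurableTypeR R) : measurableTypeR R := x + b * y.

Lemma measurable_affine x b : measurable_fun setT (affine x b).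
Proof. by apply: measurable_funD => //; apply: measurable_funM. Qed.

HB.instance Definition _ x b :=
  isMeasurableFun.Build _ _ _ _ (affine x b) (measurable_affine x b).

(** By uniqueness of Lebesgue measure it suffices to compare the two measures on the intervals ]p,
    q]. *)
Lemma lebesgue_measure_affine x b (A : set R) : b != 0 -> measurable A ->
  mu A = (`|b|%:E * pushforward mu (affine x b) A)%E.
Proof.
move=> b0 mA.
have mphi := measurable_affine x b.
(* The measure structure of [pushforward] depends on a measurability proof, which
   canonical structure inference cannot supply: hence the explicit instance. *)
pose m := measure_function_pushforward__canonical__measure_function_Measure
  mu mphi.
apply: (@lebesgue_measure_unique R (mscale (NngNum (normr_ge0 b)) m)) mA.
move=> _ [[p q] _ <-]/=.
rewrite /mscale/= /pushforward/= lebesgue_measure_itv/= lte_fin.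
case: (ltrgtP b 0) b0 => // [bn|bp] _.
(* A negative slope reverses the interval, so the closed end moves to the left. *)
- have -> : affine x b @^-1` `]p, q] = `[(q - x) / b, (p - x) / b[%classic.
    apply/funext => y; apply/propext.
    rewrite /affine/= !in_itv/= ler_ndivrMr// ltr_ndivlMr//.
    by split => /andP[? ?]; apply/andP; split; nra.
  rewrite lebesgue_measure_itv/= lte_fin ltr_ndivrMr// divfK ?lt_eqF//.
  rewrite ltrD2r; case: ifPn => pq; last by rewrite mule0.
  by rewrite -!EFinD -EFinM ltr0_norm//; congr EFin; field; rewrite lt_eqF.
- have -> : affine x b @^-1` `]p, q] = `](p - x) / b, (q - x) / b]%classic.
    apply/funext => y; apply/propext.
    rewrite /affine/= !in_itv/= ler_pdivlMr// ltr_pdivrMr//.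
    by split => /andP[? ?]; apply/andP; split; nra.
  rewrite lebesgue_measure_itv/= lte_fin ltr_pdivrMr// divfK ?gt_eqF//.
  rewrite ltrD2r; case: ifPn => pq; last by rewrite mule0.
  by rewrite -!EFinD -EFinM gtr0_norm//; congr EFin; field; rewrite gt_eqF.
Qed.

Lemma integral_affine x b (f : R -> \bar R) (A : set R) : b != 0 -> measurable A ->
  measurable_fun A f -> (forall y, 0 <= f y)%E ->
  (\int[mu]_(y in A) f y =
   `|b|%:E * \int[mu]_(y in affine x b @^-1` A) f (affine x b y))%E.
Proof.
move=> b0 mA mf f0.
rewrite -[X in (_ * X)%E]/(
  \int[mu]_(y in affine x b @^-1` A) (f \o affine x b) y)%E.
rewrite -(ge0_integral_pushforward (measurable_affine x b))//=.
rewrite -(@ge0_integral_mscale _ (measurableTypeR R) _ _ _ mA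
  (NngNum (normr_ge0 b)))//=.
by apply: eq_measure_integral => B mB _; exact: lebesgue_measure_affine.
Qed.

(** Isolates the factor 1/|s|, which cancels the Jacobian |b| of an affine substitution. *)
Lemma normal_peakE s : normal_peak s = (Num.sqrt (pi *+ 2))^-1 / `|s| :> R.
Proof.
by rewrite /normal_peak -mulrnAr sqrtrM ?sqr_ge0// sqrtr_sqr invfM mulrC.
Qed.

Lemma normal_prob_affine x b (A : set R) : b != 0 -> measurable A ->
  normal_prob 0 1 (affine x b @^-1` A) = normal_prob x b A.
Proof.
move=> b0 mA; rewrite /normal_prob [RHS](integral_affine x b)//; last 2 first.
- by apply/measurable_EFinP/measurable_funTS; exact: measurable_normal_pdf.
- by move=> y; rewrite lee_fin normal_pdf_ge0.
have mA' : measurable (affine x b @^-1` A).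
  by rewrite -[X in measurable X]setTI; exact: measurable_affine.
rewrite -[RHS]ge0_integralZl//; last 2 first.
- apply: measurable_funTS; apply: measurableT_comp => //.
  exact: measurableT_comp (measurable_normal_pdf x b) (measurable_affine x b).
- by move=> y _; rewrite lee_fin normal_pdf_ge0.
apply: eq_integral => y _; rewrite -EFinM; congr EFin.
have -> : normal_pdf 0 1 y = normal_peak 1 * normal_fun x b (affine x b y).
  rewrite normal_pdfE ?oner_eq0//; congr (_ * expR _).
  rewrite /affine subr0 addrAC subrr add0r -(mulr_natr (b ^+ 2)) expr1n.
  by rewrite -(mulr_natr 1); field.
by rewrite normal_pdfE// !normal_peakE normr1 divr1 mulrA; congr (_ * _);
  rewrite mulrC divfK// normr_eq0.
Qed.

(* Completing the square. *)
Lemma normal_pdf_mul a b x z (c := Num.sqrt (a ^+ 2 + b ^+ 2)) :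
  a != 0 -> b != 0 ->
  normal_pdf 0 a x * normal_pdf x b z =
  normal_pdf 0 c z * normal_pdf (a ^+ 2 / c ^+ 2 * z) (a * b / c) x.
Proof.
move=> a0 b0.
have c2 : c ^+ 2 = a ^+ 2 + b ^+ 2 by rewrite sqr_sqrtr// addr_ge0// sqr_ge0.
have c2_neq0 : c ^+ 2 != 0.
  by rewrite c2 paddr_eq0 ?sqr_ge0// !sqrf_eq0 (negbTE a0).
have c0 : c != 0 by rewrite -sqrf_eq0.
rewrite !normal_pdfE ?mulf_neq0 ?invr_neq0// !normal_peakE.
rewrite mulrACA [RHS]mulrACA; congr (_ * _).
  rewrite !normrM normfV; move: (Num.sqrt _)^-1 => k.
  by field; rewrite !normr_eq0 a0 b0 c0.
rewrite /normal_fun -!expRD; congr expR.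
rewrite (exprMn _ (a * b)) exprVn (exprMn _ a) c2.
rewrite c2 in c2_neq0.
by field; rewrite ?a0 ?b0 ?c2_neq0.
Qed.

Lemma measurable_normal_pdf2 b : b != 0 ->
  measurable_fun [set: mR * mR] (fun p => normal_pdf p.1 b p.2).
Proof.
move=> b0; under eq_fun do rewrite normal_pdfE//.
apply: measurable_funM => //; apply: measurableT_comp => //.
apply: measurable_funM => //; apply: measurableT_comp => //.
by apply: measurable_funX; apply: measurable_funB.
Qed.

(** Puts the set into the integrand, so that Tonelli's theorem applies to a single function of (x,
    z). *)
Lemma normal_prob_meanE x b (B : set R) :
  normal_prob x b B = (\int[mu]_z (normal_pdf x b z * \1_B z)%:E)%E.
Proof.
rewrite /normal_prob integral_mkcond; apply: eq_integral => z _.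
by rewrite patchE indicE; case: ifPn; rewrite ?mulr1 ?mulr0.
Qed.

Lemma measurable_normal_prob_mean b (B : set R) : b != 0 -> measurable B ->
  measurable_fun [set: R] (fun x => normal_prob x b B).
Proof.
move=> b0 mB; under eq_fun do rewrite normal_prob_meanE.
pose f (p : mR * mR) := (normal_pdf p.1 b p.2 * \1_B p.2)%:E.
have f0 p : (0 <= f p)%E by rewrite lee_fin mulr_ge0 ?normal_pdf_ge0.
have mf : measurable_fun setT f.
  apply/measurable_EFinP/measurable_funM; first exact: measurable_normal_pdf2.
  exact: measurableT_comp.
exact: (@measurable_fun_fubini_tonelli_F _ _ mR mR R mu f mf f0).
Qed.

(** Convolution of centred Gaussian laws: after exchanging the integrals, [normal_pdf_mul] splits
    off a normal density in x, whose integral is 1. *)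
Lemma integral_normal_prob_mean a b (B : set R) :
  a != 0 -> b != 0 -> measurable B ->
  (\int[normal_prob 0 a]_x normal_prob x b B =
   normal_prob 0 (Num.sqrt (a ^+ 2 + b ^+ 2)) B)%E.
Proof.
move=> a0 b0 mB; set c := Num.sqrt _.
have c0 : c != 0.
  by rewrite sqrtr_eq0 -ltNge ltr_wpDr ?sqr_ge0// exprn_even_gt0.
pose f (p : mR * mR) : \bar R :=
  (normal_pdf 0 a p.1 * normal_pdf p.1 b p.2 * \1_B p.2)%:E.
have f0 p : (0 <= f p)%E by rewrite lee_fin !mulr_ge0 ?normal_pdf_ge0.
have mf : measurable_fun setT f.
  apply/measurable_EFinP/measurable_funM; last exact: measurableT_comp.
  apply: measurable_funM; last exact: measurable_normal_pdf2.
  by apply: measurableT_comp => //; exact: measurable_normal_pdf.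
rewrite integral_normal_prob//; last exact: measurable_normal_prob_mean.
have probE x : (normal_prob x b B * (normal_pdf 0 a x)%:E = \int[mu]_z f (x, z))%E.
  rewrite muleC normal_prob_meanE -ge0_integralZl//; last 3 first.
  - apply/measurable_EFinP/measurable_funM => //; exact: measurable_normal_pdf.
  - by move=> z _; rewrite lee_fin mulr_ge0 ?normal_pdf_ge0.
  - by rewrite lee_fin normal_pdf_ge0.
  by apply: eq_integral => z _; rewrite /f/= -mulrA EFinM.
under eq_integral do rewrite probE.
rewrite (@fubini_tonelli _ _ mR mR R mu mu f)// normal_prob_meanE.
apply: eq_integral => z _.
transitivity (\int[mu]_x ((normal_pdf 0 c z * \1_B z)%:E *
    (normal_pdf (a ^+ 2 / c ^+ 2 * z) (a * b / c) x)%:E))%E.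
  by apply: eq_integral => x _; rewrite /f/= normal_pdf_mul// -EFinM mulrAC.
rewrite ge0_integralZl//; last 3 first.
- by apply/measurable_EFinP; exact: measurable_normal_pdf.
- by move=> x _; rewrite lee_fin normal_pdf_ge0.
- by rewrite lee_fin mulr_ge0 ?normal_pdf_ge0.
by rewrite integral_normal_pdf mule1.
Qed.

End Gaussian.

(** * Small balls and an exponential moment of N(0, 1) *)

Section GaussianBounds.
Context {R : realType}.
Local Notation mu := (@lebesgue_measure R).
Implicit Types (x : R).

Lemma normal_prob_small_ball (delta : R) : 0 < delta ->
  (normal_prob 0 1 [set x : R | (x ^+ 2 < delta ^+ 2)%R] <= delta%:E)%E.
Proof.
move=> d0.
have -> : [set x : R | x ^+ 2 < delta ^+ 2] = `](- delta), delta[%classic.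
  apply/seteqP; split => x /=; rewrite in_itv/= -ltr_norml
    -(real_normK (num_real x)).
    by rewrite ltr_pXn2r// ?nnegrE// ltW.
  by rewrite ltr_pXn2r// ?nnegrE// ltW.
have le_int : (normal_prob 0 1 `](- delta)%R, delta[ <=
    \int[mu]_(x in `](- delta)%R, delta[) (2^-1 : R)%:E)%E.
  apply: ge0_le_integral => //.
  - by move=> x _; rewrite lee_fin normal_pdf_ge0.
  - by apply/measurable_EFinP/measurable_funTS; exact: measurable_normal_pdf.
  move=> x _; rewrite lee_fin (le_trans (normal_pdf_ub _ _ (oner_neq0 _)))//.
  rewrite normal_peakE normr1 divr1 lef_pV2 ?posrE//; last first.
    by rewrite sqrtr_gt0 pmulrn_lgt0// pi_gt0.
  (* 2 pi >= 4 bounds the peak 1 / sqrt (2 pi) by 1/2. *)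
  have pi2 : 4 <= pi *+ 2 :> R by have := pi_ge2 R; lra.
  rewrite -(@ler_pXn2r _ 2)// ?nnegrE ?sqrtr_ge0// sqr_sqrtr;
    last exact: le_trans pi2.
  by apply: le_trans pi2; lra.
apply: (le_trans le_int).
rewrite integral_cst//= lebesgue_measure_itv/= lte_fin gtrN// -EFinD -EFinM lee_fin.
lra.
Qed.

(** exp(x^2 / 4) times the N(0, 1) density is sqrt 2 times the N(0, 2) density, since 1/4 - 1/2 =
    -1/4. *)
Lemma integral_exp_sqr_normal :
  (\int[normal_prob 0 1]_x (expR (x ^+ 2 / 4%:R))%:E = (Num.sqrt 2 : R)%:E)%E.
Proof.
have s2 : Num.sqrt 2 != 0 :> R by rewrite gt_eqF// sqrtr_gt0.
have s0 : 0 <= Num.sqrt 2 :> R by rewrite sqrtr_ge0.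
have mE : measurable_fun [set: R] (fun x : R => expR (x ^+ 2 / 4%:R)).
  apply: measurableT_comp => //; apply: measurable_funM => //.
rewrite integral_normal_prob//; last first.
  exact/measurable_EFinP.
transitivity (\int[mu]_x ((Num.sqrt 2 : R)%:E *
    (normal_pdf 0 (Num.sqrt 2) x)%:E))%E.
  apply: eq_integral => x _; rewrite -!EFinM; congr EFin.
  rewrite !normal_pdfE ?oner_eq0// !normal_peakE normr1 divr1 (ger0_norm s0).
  rewrite [LHS]mulrCA /normal_fun -expRD sqr_sqrtr//.
  rewrite [RHS]mulrA (mulrCA (Num.sqrt 2)) divff// mulr1.
  by congr (_ * expR _); field.
rewrite ge0_integralZl//; last 2 first.
- by apply/measurable_EFinP; exact: measurable_normal_pdf.
- by move=> x _; rewrite lee_fin normal_pdf_ge0.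
by rewrite integral_normal_pdf mule1.
Qed.

End GaussianBounds.

(** * Convexity and Markov's inequality for the exponential *)

(** Jensen's inequality, from the tangent at the mean m: exp y >= exp m (1 + (y - m)), and the terms
    y_i - m average to 0. *)
Lemma expR_convex_sum (R : realType) (I : finType) (p y : I -> R) :
  (forall i, 0 <= p i) -> \sum_i p i = 1 ->
  expR (\sum_i p i * y i) <= \sum_i p i * expR (y i).
Proof.
move=> p0 p1; set m := \sum_i p i * y i.
have -> : expR m = \sum_i p i * (expR m * (1 + (y i - m))).
  under eq_bigr do rewrite mulrCA.
  rewrite -mulr_sumr -[LHS]mulr1; congr (_ * _).
  under eq_bigr do rewrite mulrDr mulr1 mulrBr.
  by rewrite big_split/= p1 sumrB -/m -mulr_suml p1 mul1r subrr addr0.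
apply: ler_sum => i _; apply: ler_wpM2l => //.
have -> : expR (y i) = expR m * expR (y i - m) by rewrite -expRD addrC subrK.
by apply: ler_wpM2l; [exact: expR_ge0|exact: expR_ge1Dx].
Qed.

Lemma chernoff_bound (R : realType) (dT : measure_display) (T : measurableType dT)
    (P : probability T R) (Y : T -> R) (t : R) : measurable_fun setT Y ->
  ((expR t)%:E * P [set omega | (t <= Y omega)%R] <=
   \int[P]_omega (expR (Y omega))%:E)%E.
Proof.
move=> mY.
have mE : measurable [set omega | t <= Y omega].
  rewrite -[X in measurable X]setTI (_ : [set _ | _] = Y @^-1` `[t, +oo[%classic).
    exact: mY.
  by apply/seteqP; split => omega /=; rewrite in_itv/= andbT.
have mexp : measurable_fun setT (fun omega => (expR (Y omega))%:E).
  by apply/measurable_EFinP; exact: measurableT_comp.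
rewrite -integral_cst//.
apply: (@le_trans _ _ (
    \int[P]_(omega in [set omega | (t <= Y omega)%R]) (expR (Y omega))%:E)%E).
  apply: ge0_le_integral => //.
  - by move=> omega _; rewrite lee_fin expR_ge0.
  - exact: measurable_funTS.
  - by move=> omega /= tY; rewrite lee_fin ler_expR.
by apply: ge0_subset_integral => // omega _; rewrite lee_fin expR_ge0.
Qed.

(** * Centred Gaussian laws, the degenerate one included *)

Section GaussianLaw.
Context {R : realType}.
Implicit Types (a b m s : R).

(* N(0, s^2); the library's [normal_prob 0 0] is uniform on [0, 1], not a point
   mass. *)
Definition gauss s : probability (measurableTypeR R) R :=
  if s == 0 then (\d_(0 : measurableTypeR R) : probability _ R)
  else (normal_prob 0 s : probability _ R).

Lemma normal_prob_norm m s : normal_prob m `|s| = normal_prob m s.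
Proof.
rewrite /normal_prob (_ : normal_pdf m `|s| = normal_pdf m s)//.
rewrite /normal_pdf normr_eq0; case: eqP => // _.
by rewrite /normal_peak /normal_fun real_normK ?num_real.
Qed.

Lemma gauss0 (A : set R) : gauss 0 A = \d_(0 : measurableTypeR R) A.
Proof. by rewrite /gauss eqxx. Qed.

Lemma gaussE s (A : set R) : s != 0 -> gauss s A = normal_prob 0 s A.
Proof. by move=> /negbTE s0; rewrite /gauss s0. Qed.

Lemma gauss_norm s (A : set R) : gauss `|s| A = gauss s A.
Proof.
have [->|s0] := eqVneq s 0; first by rewrite normr0.
have ns0 : `|s| != 0 by rewrite normr_eq0.
by rewrite (gaussE _ _ s0) (gaussE _ _ ns0) normal_prob_norm.
Qed.

(** The law of G + b Y for independent G of law [gauss a] and standard normal Y, where G = x leaves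
    an affine preimage for Y. *)
Lemma gauss_convE a b (A : set R) : measurable A ->
  (\int[gauss a]_x normal_prob 0 1 (affine x b @^-1` A) =
   gauss (Num.sqrt (a ^+ 2 + b ^+ 2)) A)%E.
Proof.
move=> mA; have prob1 : normal_prob 0 1 [set: R] = 1%E by exact: probability_setT.
(* For b = 0 the map [affine x 0] is constant, so the inner probability is the indicator of A. *)
have [->|b0] := eqVneq b 0.
  have -> : Num.sqrt (a ^+ 2 + 0 ^+ 2) = `|a| by rewrite expr0n addr0 sqrtr_sqr.
  rewrite gauss_norm.
  transitivity (\int[gauss a]_x (\1_A x)%:E)%E;
    last by rewrite integral_indic// setIT.
  apply: eq_integral => x _; rewrite indicE.
  have [xA|xA] := boolP (x \in A).
    rewrite (_ : affine x 0 @^-1` A = setT)//; apply/seteqP; split => // y _.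
    by rewrite /affine/= mul0r addr0; exact: set_mem.
  rewrite (_ : affine x 0 @^-1` A = set0) ?measure0//.
  apply/seteqP; split => // y /=.
  by rewrite /affine/= mul0r addr0 => /mem_set; rewrite (negbTE xA).
have c0 : Num.sqrt (a ^+ 2 + b ^+ 2) != 0.
  by rewrite sqrtr_eq0 -ltNge ltr_wpDl ?sqr_ge0// exprn_even_gt0.
under eq_integral do rewrite normal_prob_affine//.
rewrite (gaussE _ _ c0).
have [a0|a0] := eqVneq a 0.
  have -> : Num.sqrt (a ^+ 2 + b ^+ 2) = `|b|.
    by rewrite a0 expr0n add0r sqrtr_sqr.
  rewrite (eq_measure_integral (\d_(0 : measurableTypeR R))); last first.
    by move=> B _ _; rewrite a0; exact: gauss0.
  rewrite integral_dirac//; last exact: measurable_normal_prob_mean.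
  by rewrite diracT mul1e normal_prob_norm.
rewrite (eq_measure_integral (normal_prob 0 a));
  last by move=> B _ _; exact: gaussE.
exact: integral_normal_prob_mean.
Qed.
End GaussianLaw.

(** * Linear and quadratic forms in independent standard normal variables *)

Section LinearForm.
Context {R : realType} {dT : measure_display} {T : measurableType dT}.
Context (P : probability T R) (d : nat) (W : 'I_d -> T -> R).
Hypothesis mW : forall i, measurable_fun setT (W i).
Hypothesis W_box : forall B : 'I_d -> set R, (forall i, measurable (B i)) ->
  P [set omega | forall i, B i (W i omega)] =
  (\prod_(i < d) normal_prob 0 1 (B i))%E.
Local Notation mR := (measurableTypeR R).
Implicit Types (u : 'I_d -> R) (A : set R) (B : 'I_d -> set R).

Definition partial_form u k omega := \sum_(i < d | (i < k)%N) u i * W i omega.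

Lemma measurable_partial_form u k : measurable_fun setT (partial_form u k).
Proof.
rewrite (_ : partial_form u k = fun omega =>
    \sum_(i < d) (if (i < k)%N then u i * W i omega else 0)); last first.
  by apply/funext => omega; rewrite /partial_form big_mkcond.
by apply: measurable_sum => i; case: (i < k)%N => //; exact: measurable_funM.
Qed.

Lemma measurable_box B (p : pred 'I_d) : (forall i, measurable (B i)) ->
  measurable [set omega | forall i, p i -> B i (W i omega)].
Proof.
move=> mB.
rewrite (_ : [set _ | _] = \bigcap_(i in [set i | p i]) (W i @^-1` B i)).
  apply: fin_bigcap_measurable => // i _; rewrite -[X in measurable X]setTI.
  exact: mW.
by apply/seteqP; split => omega /=.
Qed.

(** Induction on k. The boxes for the coordinates from k on carry the independence of the partial
    form from these coordinates through the induction. *)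
Lemma partial_form_law u k A B : (k <= d)%N -> measurable A ->
  (forall i, measurable (B i)) ->
  P [set omega | A (partial_form u k omega) /\
       forall i : 'I_d, (k <= i)%N -> B i (W i omega)] =
  (gauss (Num.sqrt (\sum_(i < d | (i < k)%N) u i ^+ 2)) A *
   \prod_(i < d | (k <= i)%N) normal_prob 0 1 (B i))%E.
Proof.
elim: k A B => [|k IH] A B kd mA mB.
  (* The empty form is 0, with the point mass [gauss 0] as its law. *)
  rewrite big_pred0// sqrtr0 gauss0 diracE -W_box//.
  have S0 omega : partial_form u 0 omega = 0 by rewrite /partial_form big_pred0.
  have [A0|A0] := boolP (0 \in A); last first.
    rewrite mul0e (_ : [set _ | _] = set0) ?measure0//.
    apply/seteqP; split => // omega /=; rewrite S0 => -[/mem_set].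
    by rewrite (negbTE A0).
  rewrite mul1e; congr (P _); apply/seteqP; split => omega /=.
    by move=> [_ ]BW i; exact: BW.
  by move=> BW; rewrite S0; split => //; exact: set_mem.
pose o : 'I_d := Ordinal kd; set a := Num.sqrt _; set c := (\prod_(i < d | _) _)%E.
pose s := Num.sqrt (\sum_(i < d | (i < k)%N) u i ^+ 2).
have ltE (i : 'I_d) : (i < k.+1)%N && (i != o) = (i < k)%N.
  by rewrite ltnS [RHS]ltn_neqAle andbC -val_eqE.
have geE (i : 'I_d) : (k <= i)%N && (i != o) = (k < i)%N.
  by rewrite [RHS]ltn_neqAle andbC -val_eqE/= eq_sym.
have aE : a = Num.sqrt (s ^+ 2 + u o ^+ 2).
  rewrite /s sqr_sqrtr ?sumr_ge0// => [|i _]; last exact: sqr_ge0.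
  rewrite /a (bigD1 o)/=; last exact: ltnSn.
  by rewrite addrC; congr (Num.sqrt (_ + _)); apply: eq_bigl => i; exact: ltE.
have SE omega :
    partial_form u k.+1 omega = partial_form u k omega + u o * W o omega.
  rewrite /partial_form (bigD1 o)/=; last exact: ltnSn.
  by rewrite addrC; congr (_ + _); apply: eq_bigl => i; exact: ltE.
pose E := [set omega | forall i : 'I_d, (k < i)%N -> B i (W i omega)].
have mE : measurable E by exact: measurable_box.
(* [mscale] takes a nonnegative real factor, hence the product of [fine] values. *)
pose r := \prod_(i < d | (k < i)%N) fine (normal_prob 0 1 (B i)).
have cE : c = r%:E.
  rewrite /c /r (big_morph EFin EFinM (erefl _)); apply: eq_bigr => i _.
  by rewrite fineK//; apply: fin_num_measure; exact (mB i).
have r0 : 0 <= r by apply: prodr_ge0 => i _; rewrite fine_ge0.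
pose X omega : mR * mR := (partial_form u k omega, W o omega).
have mX : measurable_fun setT X.
  by apply/measurable_fun_pairP; split; [exact: measurable_partial_form|exact: mW].
(* [m'] is the joint law of the partial form and coordinate k, restricted to the event [E] on the
   later coordinates. It factors on rectangles, so it is the product of [m1] and N(0, 1). *)
pose m1 := mscale (NngNum r0) (gauss s).
pose m' := measure_function_pushforward__canonical__measure_function_Measure
  (mrestr P mE) mX.
have m'E (A1 A2 : set mR) : measurable A1 -> measurable A2 ->
    m' (A1 `*` A2) = (m1 A1 * normal_prob 0 1 A2)%E.
  move=> mA1 mA2.
  (* Coordinate k gets the box A2, so that the induction hypothesis covers the rectangle. *)
  pose B' i : set R := if i == o then A2 else B i.
  have mB' i : measurable (B' i) by rewrite /B'; case: ifP.
  rewrite /m'/= /pushforward /mrestr.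
  rewrite (_ : _ `&` E = [set omega | A1 (partial_form u k omega) /\
       forall i : 'I_d, (k <= i)%N -> B' i (W i omega)]); last first.
    apply/seteqP; split => omega /=.
      move=> [[? ?] EB]; split => // i ki; rewrite /B'; case: eqVneq => [->//|io].
      by apply: EB; rewrite -geE ki.
    move=> [? EB]; split; first split => //.
      by have := EB o (leqnn _); rewrite /B' eqxx.
    move=> i ki; have := EB i (ltnW ki); rewrite /B'; case: eqVneq => // io.
    by move: ki; rewrite io ltnn.
  rewrite (IH A1 B' (ltnW kd) mA1 mB').
  rewrite [X in (_ * X)%E](bigD1 o)//= {1}/B' eqxx /m1 /mscale/= -cE.
  rewrite (eq_big (fun i : 'I_d => (k < i)%N)
    (fun i => normal_prob 0 1 (B i))) => [||i].
  - by rewrite -/c -/s muleA muleC muleA.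
  - exact: geE.
  - by rewrite /B' => /andP[_ /negbTE->].
(* Pairs for which the form with coordinate k added lies in A; the sections of [D] are affine
   preimages of A. *)
pose D : set (mR * mR) := [set p | A (p.1 + u o * p.2)].
have mD : measurable D.
  have mf : measurable_fun setT (fun p : mR * mR => p.1 + u o * p.2 : mR).
    by apply: measurable_funD => //; apply: measurable_funM.
  by rewrite -[X in measurable X]setTI; exact: mf.
transitivity (m' D).
  rewrite /m'/= /pushforward /mrestr; congr (P _); apply/seteqP; split => omega /=.
    by rewrite SE.
  by rewrite /D/= SE.
rewrite -(product_measure_unique m'E mD).
rewrite /product_measure1/= ge0_integral_mscale//=;
  last exact: measurable_fun_xsection.
rewrite cE aE -gauss_convE// muleC; congr (_ * _)%E.
apply: eq_integral => x _; congr (normal_prob 0 1 _).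
by apply/seteqP; split => y; rewrite /xsection/= inE.
Qed.

Lemma linear_form_law u A : measurable A -> \sum_i u i ^+ 2 = 1 ->
  P [set omega | A (\sum_i u i * W i omega)] = normal_prob 0 1 A.
Proof.
move=> mA u1.
have := @partial_form_law u d A (fun=> setT) (leqnn _) mA (fun=> measurableT).
rewrite [X in (_ * X)%E]big1 => [|i _]; last exact: probability_setT.
have dE : (fun i : 'I_d => (i < d)%N) =1 xpredT by move=> i; rewrite ltn_ord.
rewrite (eq_bigl _ _ dE) u1 sqrtr1 mule1 gaussE ?oner_eq0// => <-; congr (P _).
apply/seteqP; split => omega /=; rewrite /partial_form (eq_bigl _ _ dE) => //.
by case.
Qed.

Lemma expectation_exp_sqr_linear_form (u : 'I_d -> R) : \sum_i u i ^+ 2 = 1 ->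
  (\int[P]_omega (expR ((\sum_i u i * W i omega) ^+ 2 / 4%:R))%:E =
   (Num.sqrt 2 : R)%:E)%E.
Proof.
move=> u1; pose Z omega : measurableTypeR R := \sum_i u i * W i omega.
have mZ : measurable_fun setT Z.
  by apply: measurable_sum => i; exact: measurable_funM.
pose f (x : measurableTypeR R) := (expR (x ^+ 2 / 4%:R))%:E.
have mf : measurable_fun setT f.
  apply/measurable_EFinP; apply: measurableT_comp => //; exact: measurable_funM.
rewrite -integral_exp_sqr_normal -[LHS]/(\int[P]_omega (f \o Z) omega)%E.
rewrite -(preimage_setT Z) -(ge0_integral_pushforward mZ)//; last first.
  by move=> x _; rewrite lee_fin expR_ge0.
by apply: eq_measure_integral => A mA _; exact: linear_form_law.
Qed.

(** With weights p_i = |row i|^2 / F, the form divided by 4 F is a convex combination of Z_i^2 / 4,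
    where Z_i is the form of the normalised row i. Markov's and Jensen's inequalities then give the
    tail. *)
Lemma gaussian_quadratic_tail (m : nat) (A : 'M[R]_(m, d)) (s : R) :
    0 < \sum_i \sum_j A i j ^+ 2 ->
  ((expR s)%:E * P [set omega | (4%:R * s * \sum_i \sum_j A i j ^+ 2 <=
                   \sum_i (\sum_j A i j * W j omega) ^+ 2)%R] <=
   (Num.sqrt 2 : R)%:E)%E.
Proof.
set F := \sum_i _ => F0; pose q i := \sum_j A i j ^+ 2.
have q0 i : 0 <= q i by apply: sumr_ge0 => j _; exact: sqr_ge0.
pose p i := q i / F.
have p0 i : 0 <= p i by rewrite divr_ge0// ltW.
have p1 : \sum_i p i = 1 by rewrite -mulr_suml divff// gt_eqF.
(* A zero row stays zero here, since division by 0 gives 0. *)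
pose u i j := A i j / Num.sqrt (q i).
have rowE i omega : (\sum_j A i j * W j omega) ^+ 2 =
    q i * (\sum_j u i j * W j omega) ^+ 2.
  have [qi0|qi0] := eqVneq (q i) 0.
    rewrite qi0 mul0r big1 ?expr0n// => j _.
    suff /eqP -> : A i j == 0 by rewrite mul0r.
    rewrite -sqrf_eq0; move/eqP: qi0; rewrite psumr_eq0 => [/allP/(_ j)|k _];
      last exact: sqr_ge0.
    by rewrite mem_index_enum => /(_ isT).
  rewrite -[q i in RHS]sqr_sqrtr// -exprMn mulr_sumr; congr (_ ^+ 2).
  apply: eq_bigr => j _; rewrite /u mulrA mulrCA divff ?mulr1//.
  by rewrite sqrtr_eq0 -ltNge lt_neqAle eq_sym qi0 q0.
have u1 i : q i != 0 -> \sum_j u i j ^+ 2 = 1.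
  move=> qi0; under eq_bigr do rewrite /u exprMn exprVn sqr_sqrtr//.
  by rewrite -mulr_suml divff.
pose Y omega := (\sum_i (\sum_j A i j * W j omega) ^+ 2) / (4%:R * F).
have mL (v : 'I_d -> R) : measurable_fun setT (fun omega => \sum_j v j * W j omega).
  by apply: measurable_sum => j; exact: measurable_funM.
have mY : measurable_fun setT Y.
  apply: measurable_funM => //; apply: measurable_sum => i.
  exact: measurable_funX.
have YE omega : Y omega = \sum_i p i * ((\sum_j u i j * W j omega) ^+ 2 / 4%:R).
  rewrite /Y mulr_suml; apply: eq_bigr => i _; rewrite rowE /p.
  by field; rewrite gt_eqF.
rewrite (_ : [set omega | _] = [set omega | s <= Y omega]); last first.
  apply/seteqP; split => omega /=.
    by rewrite /Y ler_pdivlMr ?mulr_gt0// mulrCA mulrA.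
  by rewrite /Y ler_pdivlMr ?mulr_gt0// mulrCA mulrA.
apply: (le_trans (chernoff_bound _ _ _ P Y s mY)).
pose g i omega := ((p i)%:E *
  (expR ((\sum_j u i j * W j omega)%R ^+ 2 / 4%:R))%:E)%E.
have mexp i : measurable_fun setT
    (fun omega => (expR ((\sum_j u i j * W j omega) ^+ 2 / 4%:R))%:E).
  apply/measurable_EFinP; apply: measurableT_comp => //.
  apply: measurable_funM => //; exact: measurable_funX.
have mg i : measurable_fun setT (g i) by exact: emeasurable_funM.
have g0 i omega : (0 <= g i omega)%E by rewrite mule_ge0// lee_fin ?expR_ge0.
have le_int : (\int[P]_omega (expR (Y omega))%:E <=
    \int[P]_omega (\sum_i g i omega))%E.
  apply: ge0_le_integral => //.
  - apply/measurable_EFinP; exact: measurableT_comp (@measurable_expR R) mY.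
  - by apply: emeasurable_sum => i; exact: mg.
  move=> omega _; rewrite /g; under eq_bigr do rewrite -EFinM.
  by rewrite sumEFin lee_fin YE; exact: expR_convex_sum.
apply: (le_trans le_int).
rewrite ge0_integral_sum//.
rewrite (eq_bigr (fun i => (p i * Num.sqrt 2)%:E)) => [|i _].
  by rewrite sumEFin -mulr_suml p1 mul1r.
rewrite /g ge0_integralZl ?lee_fin//.
(* A zero row has no unit normalisation, but both sides carry its weight p_i = 0. *)
have [qi0|qi0] := eqVneq (q i) 0.
  by rewrite /p qi0 !mul0r mul0e.
by rewrite expectation_exp_sqr_linear_form// u1.
Qed.

End LinearForm.

(** * Leading eigenvectors of Gram matrices *)

Section LeadingEigenvector.
Context {R : realType} {d n : nat} (X : 'M[R]_(d, n)) (A : 'M[R]_d).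
Hypothesis AE : A = n%:R^-1 *: (X *m X^T).
Implicit Types (x y : 'cV[R]_d) (l : R).

Lemma gram_sym : A^T = A.
Proof. by rewrite AE linearZ/= trmx_mul trmxK. Qed.

Lemma gram_psd x : 0 <= inner x (A *m x).
Proof.
rewrite -innerE AE -scalemxAl -scalemxAr mxE mulr_ge0// ?invr_ge0//.
have -> : x^T *m (X *m X^T *m x) = (X^T *m x)^T *m (X^T *m x).
  by rewrite trmx_mul trmxK !mulmxA.
by rewrite innerE inner_ge0.
Qed.

Lemma inner_mulmx x y l : A *m x = l *: x -> inner x (A *m y) = l * inner x y.
Proof.
move=> Ax; rewrite -!innerE mulmxA -{1}gram_sym -trmx_mul Ax linearZ/= -scalemxAl.
by rewrite mxE.
Qed.

(** Semidefiniteness at v gives l >= 0, and l = 0 would make every column A e_j vanish by |A x| <= l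
    |x|. The same inequality bounds the spectral norm. *)
Lemma leading_eigenvalue_bounds (v : 'cV[R]_d) l :
  A != 0 -> v != 0 -> A *m v = l *: v ->
  (forall a, eigenvalue A a -> a <= l) -> 0 < l /\ 0 <= spectral_norm A <= l.
Proof.
move=> A0 v0 Av Al.
have l0 : 0 <= l.
  have := gram_psd v; rewrite (inner_mulmx _ _ _ Av) pmulr_lge0//.
  by rewrite lt_neqAle inner_ge0 eq_sym inner_eq0 v0.
have Ale x : inner (A *m x) (A *m x) <= l ^+ 2 * inner x x.
  by apply: norm_mulmx_psd => //; [exact: gram_psd|exact: gram_sym].
split; last exact: spectral_norm_le.
rewrite lt_neqAle l0 andbT; apply: contra A0 => /eqP l_eq0.
apply/eqP/matrixP => i j; rewrite [RHS]mxE.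
have := Ale (delta_mx j 0); rewrite -l_eq0 expr0n mul0r => Aj.
have /eqP : inner (A *m delta_mx j 0) (A *m delta_mx j 0) == 0.
  by rewrite eq_le Aj inner_ge0.
by move/eqP; rewrite inner_eq0 -colE => /eqP/matrixP/(_ i 0); rewrite !mxE.
Qed.

End LeadingEigenvector.

(** * From the two tail bounds to the probability estimate *)

(** Brings the tail probability sqrt 2 / d^3 below 1 / d. *)
Lemma sqrt2_le_sqr (R : realType) (k : nat) : (2 <= k)%N ->
  Num.sqrt 2 <= k%:R ^+ 2 :> R.
Proof.
move=> k2; have k2R : 2 <= k%:R :> R by rewrite ler_nat.
apply: (@le_trans _ _ 2); last by nra.
by rewrite -(@ler_pXn2r _ 2)// ?nnegrE ?sqrtr_ge0// sqr_sqrtr//; lra.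
Qed.

(** Squaring removes the root in [norm2]; for v = 0 both sides are 0, as 0^-1 = 0. *)
Lemma inner_normalize (R : realType) (d : nat) (u v : 'cV[R]_d) :
  inner u (normalize v) ^+ 2 = inner u v ^+ 2 / inner v v.
Proof.
rewrite /normalize -innerE -scalemxAr mxE innerE exprMn exprVn norm2_sqr.
by rewrite mulrC.
Qed.

Theorem lemma1 (R : realType) (d n : nat) (hd : (2 <= d)%N)
    (X : 'M[R]_(d, n)) (A : 'M[R]_d)
    (hA : A = n%:R^-1 *: (X *m X^T)) (hA0 : A != 0)
    (v1 : 'cV[R]_d) (hv1 : leading_eigenvector A v1) (hv1_unit : norm2 v1 = 1)
    (dT : measure_display) (T : measurableType dT) (P : probability T R)
    (w : {RV P >-> d.-tuple R}) (hw : standard_gaussian (distribution P w))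
    (delta : R) (hdelta : 0 < delta) :
  ((1 - d%:R^-1 - delta)%:E <=
   P [set omega | (delta ^+ 2 / (12%:R * ln d%:R * nrank A) <=
                   inner v1 (normalize (A *m cvec (w omega))) ^+ 2)%R])%E.
Proof.
case: hv1 => v0 [l [Av Al]].
have [l0 /andP[sp0 spl]] := leading_eigenvalue_bounds _ _ hA v1 l hA0 v0 Av Al.
pose W i omega := tnth (w omega) i.
have mW i : measurable_fun setT (W i).
  exact: measurableT_comp (measurable_tnth i) (measurable_funPT w).
have W_box B : (forall i, measurable (B i)) ->
    P [set omega | forall i, B i (W i omega)] =
    (\prod_(i < d) normal_prob 0 1 (B i))%E.
  by move=> mB; rewrite -(hw B mB).
have mL (u : 'I_d -> R) : measurable_fun setT (fun omega => \sum_j u j * W j omega).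
  by apply: measurable_sum => j; exact: measurable_funM.
pose Z omega := \sum_i v1 i 0 * W i omega.
pose Q omega := \sum_i (\sum_j A i j * W j omega) ^+ 2.
have mQ : measurable_fun setT Q.
  by apply: measurable_sum => i; apply: measurable_funX.
have ZE omega : inner v1 (cvec (w omega)) = Z omega.
  by apply: eq_bigr => i _; rewrite mxE.
have QE omega : inner (A *m cvec (w omega)) (A *m cvec (w omega)) = Q omega.
  apply: eq_bigr => i _; rewrite -expr2 mxE; congr (_ ^+ 2).
  by apply: eq_bigr => j _; rewrite mxE.
pose F := \sum_i \sum_j A i j ^+ 2.
have F0 : 0 < F.
  rewrite lt_neqAle sumr_ge0 ?andbT => [|i _];
    last by apply: sumr_ge0 => j _; exact: sqr_ge0.
  apply: contra hA0; rewrite eq_sym psumr_eq0 => [/allP F0|i _]; last first.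
    by apply: sumr_ge0 => j _; exact: sqr_ge0.
  apply/eqP/matrixP => i j; rewrite mxE.
  have := F0 i (mem_index_enum i).
  rewrite psumr_eq0 => [/allP/(_ j (mem_index_enum j))|k _];
    last exact: sqr_ge0.
  by rewrite sqrf_eq0 => /eqP.
pose lnd : R := ln d%:R.
have d0 : 0 < d%:R :> R by rewrite ltr0n (leq_trans _ hd).
have lnd0 : 0 < lnd by rewrite ln_gt0// ltr1n.
(* The two bad events: a small <v1, w>^2 in the numerator and a large |A w|^2 in the denominator. *)
pose B1 := [set omega | Z omega ^+ 2 < delta ^+ 2].
pose B2 := [set omega | 12%:R * lnd * F <= Q omega].
have v1_sqr : \sum_i v1 i 0 ^+ 2 = 1.
  by rewrite -[RHS](expr1n _ 2) -hv1_unit norm2_sqr;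
    apply: eq_bigr => i _; rewrite expr2.
have mS : measurable [set x : R | x ^+ 2 < delta ^+ 2].
  rewrite -[X in measurable X]setTI
    -[[set x : R | _]]/((fun x => x ^+ 2) @^-1` [set y | y < delta ^+ 2]).
  rewrite (_ : [set y | y < delta ^+ 2] = `]-oo, (delta ^+ 2)[%classic); last first.
    by apply/seteqP; split => y /=; rewrite in_itv.
  exact: (@measurable_funX _ _ _ setT (@idfun R) 2 (@measurable_id _ _ _)).
have mB1 : measurable B1.
  by rewrite -[X in measurable X]setTI; exact: (mL (fun i => v1 i 0) _ _ mS).
have mB2 : measurable B2.
  rewrite -[X in measurable X]setTI
    (_ : B2 = Q @^-1` `[12%:R * lnd * F, +oo[%classic).
    exact: mQ.
  by apply/seteqP; split => omega /=; rewrite in_itv/= andbT.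
have PB1 : (P B1 <= delta%:E)%E.
  rewrite (linear_form_law P d W mW W_box (fun i => v1 i 0) _ mS v1_sqr).
  exact: normal_prob_small_ball.
have PB2 : (P B2 <= (d%:R^-1)%:E)%E.
  (* s = 3 log d makes 4 s = 12 log d and exp s = d^3. *)
  have := gaussian_quadratic_tail P d W mW W_box d A (lnd *+ 3) F0.
  have -> : 4%:R * (lnd *+ 3) * \sum_i \sum_j A i j ^+ 2 = 12%:R * lnd * F.
    by rewrite -(mulr_natl lnd 3) mulrA -natrM.
  rewrite -[[set omega | _]]/B2.
  rewrite -(fineK (fin_num_measure P _ mB2)) -EFinM !lee_fin => h.
  have e3 : expR (lnd *+ 3) = d%:R ^+ 3.
    by rewrite -(mulr_natr lnd 3) expRM_natr lnK.
  rewrite e3 in h.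
  rewrite -(@ler_pM2l _ (d%:R ^+ 3)) ?exprn_gt0//.
  rewrite (le_trans h)// exprSr mulfK ?gt_eqF//.
  exact: sqrt2_le_sqr.
set S := [set omega | _].
have SE omega : S omega <->
    delta ^+ 2 / (12%:R * lnd * nrank A) <= (l * Z omega) ^+ 2 / Q omega.
  by rewrite /S/= inner_normalize (inner_mulmx _ _ hA _ _ _ Av) ZE QE.
have Q0 omega : 0 <= Q omega by apply: sumr_ge0 => i _; exact: sqr_ge0.
have mSS : measurable S.
  (* [measurable_powR] covers the power -1, which equals the inverse on nonnegative numbers, 0
     included. *)
  rewrite (_ : S = (fun omega => (l * Z omega) ^+ 2 * (Q omega) `^ (-1)) @^-1`
     `[delta ^+ 2 / (12%:R * lnd * nrank A), +oo[%classic); last first.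
    apply/funext => omega; apply/propext.
    by rewrite /= in_itv/= andbT powR_inv1//; exact: SE.
  rewrite -[X in measurable X]setTI.
  suff : measurable_fun setT (fun omega =>
      (l * Z omega) ^+ 2 * (Q omega) `^ (-1)) by exact.
  apply: measurable_funM; last exact: measurableT_comp (@measurable_powR R (-1)) mQ.
  by apply: measurable_funX; apply: measurable_funM => //; exact: mL.
have BS : ~` (B1 `|` B2) `<=` S.
  move=> omega /not_orP[/negP B1o /negP B2o]; apply/SE.
  rewrite -leNgt in B1o; rewrite -ltNge in B2o.
  (* A w = 0 would give l Z = 0, hence Z = 0, against Z^2 >= delta^2 > 0 off [B1]. *)
  have Qp : 0 < Q omega.
    rewrite lt_neqAle Q0 andbT eq_sym -QE inner_eq0.
    apply/negP => /eqP Aw0.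
    have := inner_mulmx _ _ hA v1 (cvec (w omega)) l Av.
    rewrite Aw0 ZE /inner big1 => [/esym/eqP|i _]; last by rewrite mxE mulr0.
    rewrite mulf_eq0 gt_eqF//= => /eqP Z0.
    by move: B1o; rewrite Z0 expr0n/= leNgt exprn_gt0.
  have nE : nrank A = F / spectral_norm A ^+ 2.
    by rewrite /nrank sqr_sqrtr// ltW.
  have K0 : 0 < 12%:R * lnd * F by rewrite !mulr_gt0.
  (* Substituting for [nrank A] moves the squared spectral norm to the numerator, where it is at
     most l^2. *)
  have -> : delta ^+ 2 / (12%:R * lnd * nrank A) =
      (spectral_norm A * delta) ^+ 2 / (12%:R * lnd * F).
    by rewrite nE mulrA invf_div mulrCA mulrA exprMn.
  rewrite ler_pM ?sqr_ge0 ?invr_ge0 ?(ltW K0)//.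
  - rewrite !exprMn ler_pM ?sqr_ge0// ler_sqr ?nnegrE//.
    exact: ltW.
  - by rewrite lef_pV2// ltW.
(* [S] contains the complement of the union of [B1] and [B2]; the union bound concludes. *)
apply: (@le_trans _ _ (P (~` (B1 `|` B2)))); last first.
  by apply: le_measure => //; rewrite inE//; exact/measurableC/measurableU.
rewrite probability_setC; last exact: measurableU.
have PB : (P (B1 `|` B2) <= (delta + d%:R^-1)%:E)%E.
  by rewrite (le_trans (measureU2 P mB1 mB2))// EFinD leeD.
rewrite (_ : 1 - d%:R^-1 - delta = 1 - (delta + d%:R^-1)); last by ring.
by rewrite EFinB leeB.
Qed.
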